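(* Let $\Bbbk$ be an algebraically closed field, and let $\mathcal{C}$ be a Cauchy complete $\Bbbk$-linear braided monoidal category with finite dimensional morphism spaces and $\operatorname{End}(\mathbf{1})=\Bbbk$. Let $X\in\mathcal{C}$ be a non-negligible (indecomposable) object of moderate growth (such an $X$ is automatically rigid). Then $R(X)=\ker(\operatorname{Tr}_X)$. In other words, the quantum trace of every nilpotent endomorphism of $X$ is zero, but $\operatorname{Tr}_X(\operatorname{id}_X)\neq 0$.
   Context: A linear category is Cauchy complete if it admits (finite) direct sums and is idempotent (Karoubi) complete. $\mathbf{1}$ denotes the monoidal unit. An indecomposable object $X\in\mathcal{C}$ is non-negligible if there exists $Y\in\mathcal{C}$ such that $\mathbf{1}$ is a direct summand of $Y\otimes X$. An object $X$ has moderate growth if there exists $n\in\mathbb{N}$ such that $\dim_{\Bbbk}\operatorname{End}(X^{\otimes n})<n!$. An object is rigid if it admits a left dual and a right dual. $R(X)\subset\operatorname{End}(X)$ denotes the nilradical of the finite dimensional algebra $\operatorname{End}(X)$; when $X$ is indecomposable, $\operatorname{End}(X)$ is local and $R(X)$ is the set of its nilpotent elements. Quantum trace: for rigid $X$ with dual $X^*$, $\operatorname{ev}_X:X^*\otimes X\to\mathbf{1}$, $\operatorname{coev}_X:\mathbf{1}\to X\otimes X^*$, and braiding $c$, the quantum trace $\operatorname{Tr}_X:\operatorname{End}(X)\to\operatorname{End}(\mathbf{1})=\Bbbk$ is $\operatorname{Tr}_X(f):=\operatorname{ev}_{X}\circ(\operatorname{id}_{X^*}\otimes f)\circ c_{X,X^*}\circ\operatorname{coev}_X$.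 Equivalently, $\operatorname{Tr}_X(f)=\operatorname{ev}_{X^*}\circ(u_Xf\otimes\operatorname{id}_{X^*})\circ\operatorname{coev}_X$, where $u_X=(\operatorname{ev}_X\otimes\operatorname{id}_{X^{**}})\circ(c_{X,X^*}\otimes\operatorname{id}_{X^{**}})\circ(\operatorname{id}_X\otimes\operatorname{coev}_{X^*}):X\to X^{**}$ is the Drinfeld isomorphism. *)

(* Defs.v *)
From mathcomp Require Import all_boot all_order all_algebra.

Set Implicit Arguments.
Unset Strict Implicit.
Unset Printing Implicit Defensive.

Import GRing.Theory.

Declare Scope cat_scope.
Local Open Scope ring_scope.
Local Open Scope cat_scope.

Reserved Notation "g \oc f" (at level 40, left associativity).
Reserved Notation "X \ox Y" (at level 37, left associativity).
Reserved Notation "f \om g" (at level 37, left associativity).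

(** Linear categories with finite dimensional morphism spaces: finite
    dimensionality is the [vectType] structure on the morphism spaces. *)
Record linCat (k : fieldType) := LinCat {
  obj :> Type;
  hom : obj -> obj -> vectType k;
  idm : forall X, hom X X;
  comp : forall X Y Z, hom Y Z -> hom X Y -> hom X Z;
  compmA : forall X Y Z W (h : hom Z W) (g : hom Y Z) (f : hom X Y),
    comp h (comp g f) = comp (comp h g) f;
  comp1m : forall X Y (f : hom X Y), comp (idm Y) f = f;
  compm1 : forall X Y (f : hom X Y), comp f (idm X) = f;
  comp_linear_l : forall X Y Z (f : hom X Y),
    linear (fun g : hom Y Z => comp g f);
  comp_linear_r : forall X Y Z (g : hom Y Z),
    linear (fun f : hom X Y => comp g f)
}.

Notation "g \oc f" := (comp g f) : cat_scope.
Notation "'End' X" := (hom X X) (at level 10, X at level 8) : cat_scope.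

Section LinearCategory.
Variables (k : fieldType) (C : linCat k).
Implicit Types X Y Z : C.

Definition zero_object Z : Prop := idm Z = 0.

(** S is a direct sum (biproduct) of X and Y. *)
Definition direct_sum S X Y : Prop :=
  exists (i1 : hom X S) (i2 : hom Y S) (p1 : hom S X) (p2 : hom S Y),
    [/\ p1 \oc i1 = idm X, p2 \oc i2 = idm Y, p1 \oc i2 = 0, p2 \oc i1 = 0
      & i1 \oc p1 + i2 \oc p2 = idm S].

Definition direct_summand X S : Prop := exists Y, direct_sum S X Y.

Definition indecomposable X : Prop :=
  ~ zero_object X /\
  forall Y Z, direct_sum X Y Z -> zero_object Y \/ zero_object Z.

Definition has_direct_sums : Prop :=
  (exists Z, zero_object Z) /\ (forall X Y, exists S, direct_sum S X Y).

Definition idempotent_complete : Prop :=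
  forall X (e : End X), e \oc e = e ->
  exists (Y : C) (i : hom Y X) (p : hom X Y), p \oc i = idm Y /\ i \oc p = e.

Definition cauchy_complete : Prop := has_direct_sums /\ idempotent_complete.

Definition nilpotent_endo X (f : End X) : Prop :=
  exists n, iter n (fun g : End X => f \oc g) (idm X) = 0.

Definition two_sided_ideal X (I : {vspace (End X)}) : Prop :=
  forall f g : End X, f \in I -> g \oc f \in I /\ f \oc g \in I.

(** I ^ n = 0 for some n: all n-fold products of elements of I vanish. *)
Definition nilpotent_space X (I : {vspace (End X)}) : Prop :=
  exists n, forall s : seq (End X), size s = n -> {subset s <= I} ->
    foldr (fun f g : End X => f \oc g) (idm X) s = 0.

(** The nilradical R(X) of the finite dimensional algebra End X, as the union
    of its nilpotent two-sided ideals; this is its largest nilpotent ideal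
    because a sum of two nilpotent ideals is nilpotent. *)
Definition nilradical X (f : End X) : Prop :=
  exists I : {vspace (End X)},
    [/\ two_sided_ideal I, nilpotent_space I & f \in I].

End LinearCategory.

(** Linear monoidal categories, not assumed strict. *)
Record monCat (k : fieldType) := MonCat {
  moncat_lin :> linCat k;
  unit_obj : moncat_lin;
  tens : moncat_lin -> moncat_lin -> moncat_lin;
  tensm : forall X X' Y Y' : moncat_lin,
    hom X X' -> hom Y Y' -> hom (tens X Y) (tens X' Y');
  tensm_id : forall X Y, tensm (idm X) (idm Y) = idm (tens X Y);
  tensm_comp : forall (X X' X'' Y Y' Y'' : moncat_lin)
      (f' : hom X' X'') (f : hom X X') (g' : hom Y' Y'') (g : hom Y Y'),
    tensm (f' \oc f) (g' \oc g) = tensm f' g' \oc tensm f g;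
  tensm_linear_l : forall (X X' Y Y' : moncat_lin) (g : hom Y Y'),
    linear (fun f : hom X X' => tensm f g);
  tensm_linear_r : forall (X X' Y Y' : moncat_lin) (f : hom X X'),
    linear (fun g : hom Y Y' => tensm f g);
  assoc : forall X Y Z, hom (tens (tens X Y) Z) (tens X (tens Y Z));
  assocV : forall X Y Z, hom (tens X (tens Y Z)) (tens (tens X Y) Z);
  assocK : forall X Y Z, assocV X Y Z \oc assoc X Y Z = idm _;
  assocVK : forall X Y Z, assoc X Y Z \oc assocV X Y Z = idm _;
  assoc_nat : forall (X X' Y Y' Z Z' : moncat_lin)
      (f : hom X X') (g : hom Y Y') (h : hom Z Z'),
    assoc X' Y' Z' \oc tensm (tensm f g) h
    = tensm f (tensm g h) \oc assoc X Y Z;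
  lunit : forall X, hom (tens unit_obj X) X;
  lunitV : forall X, hom X (tens unit_obj X);
  lunitK : forall X, lunitV X \oc lunit X = idm _;
  lunitVK : forall X, lunit X \oc lunitV X = idm _;
  lunit_nat : forall (X X' : moncat_lin) (f : hom X X'),
    lunit X' \oc tensm (idm unit_obj) f = f \oc lunit X;
  runit : forall X, hom (tens X unit_obj) X;
  runitV : forall X, hom X (tens X unit_obj);
  runitK : forall X, runitV X \oc runit X = idm _;
  runitVK : forall X, runit X \oc runitV X = idm _;
  runit_nat : forall (X X' : moncat_lin) (f : hom X X'),
    runit X' \oc tensm f (idm unit_obj) = f \oc runit X;
  pentagon : forall W X Y Z,
    tensm (idm W) (assoc X Y Z) \oc assoc W (tens X Y) Z
      \oc tensm (assoc W X Y) (idm Z)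
    = assoc W X (tens Y Z) \oc assoc (tens W X) Y Z;
  triangle : forall X Y,
    tensm (idm X) (lunit Y) \oc assoc X unit_obj Y = tensm (runit X) (idm Y)
}.

Arguments unit_obj {k}.

Notation "X \ox Y" := (tens X Y) : cat_scope.
Notation "f \om g" := (tensm f g) : cat_scope.

Section MonoidalCategory.
Variables (k : fieldType) (C : monCat k).
Implicit Types D X Y : C.

Definition end_unit_is_base_field : Prop :=
  bijective (fun a : k => a *: idm (unit_obj C)).

Fixpoint tens_pow X (n : nat) : C :=
  if n is m.+1 then tens_pow X m \ox X else unit_obj C.

Definition moderate_growth X : Prop :=
  exists n : nat, (\dim {: End (tens_pow X n)} < n`!)%N.

Definition non_negligible X : Prop :=
  exists Y, direct_summand (unit_obj C) (Y \ox X).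

(** [duality D X] exhibits D as a left dual of X, equivalently X as a right
    dual of D. *)
Record duality D X := Duality {
  ev : hom (D \ox X) (unit_obj C);
  coev : hom (unit_obj C) (X \ox D);
  zigzag_r :
    runit X \oc (idm X \om ev) \oc assoc X D X \oc (coev \om idm X)
      \oc lunitV X = idm X;
  zigzag_l :
    lunit D \oc (ev \om idm D) \oc assocV D X D \oc (idm D \om coev)
      \oc runitV D = idm D
}.

Definition has_left_dual X : Prop := exists D, inhabited (duality D X).
Definition has_right_dual X : Prop := exists D, inhabited (duality X D).
Definition rigid X : Prop := has_left_dual X /\ has_right_dual X.

End MonoidalCategory.

Record braidedCat (k : fieldType) := BraidedCat {
  brcat_mon :> monCat k;
  braid : forall X Y : brcat_mon, hom (X \ox Y) (Y \ox X);
  braidV : forall X Y : brcat_mon, hom (Y \ox X) (X \ox Y);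
  braidK : forall X Y, braidV X Y \oc braid X Y = idm _;
  braidVK : forall X Y, braid X Y \oc braidV X Y = idm _;
  braid_nat : forall (X X' Y Y' : brcat_mon) (f : hom X X') (g : hom Y Y'),
    braid X' Y' \oc (f \om g) = (g \om f) \oc braid X Y;
  hexagon_l : forall X Y Z,
    assoc Y Z X \oc braid X (Y \ox Z) \oc assoc X Y Z
    = (idm Y \om braid X Z) \oc assoc Y X Z \oc (braid X Y \om idm Z);
  hexagon_r : forall X Y Z,
    assocV Z X Y \oc braid (X \ox Y) Z \oc assocV X Y Z
    = (braid X Z \om idm Y) \oc assocV X Z Y \oc (idm X \om braid Y Z)
}.

Section QuantumTrace.
Variables (k : fieldType) (C : braidedCat k) (D X : C).

(** The value lies in End(1), which is identified with k through
    [end_unit_is_base_field]. *)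
Definition quantum_trace (d : duality D X) (f : End X) : End (unit_obj C) :=
  ev d \oc (idm D \om f) \oc braid X D \oc coev d.

End QuantumTrace.

(* Main.v *)
From HB Require Import structures.
From mathcomp Require Import all_boot all_order all_algebra falgebra.
Require Import Defs.

Set Implicit Arguments.
Unset Strict Implicit.
Unset Printing Implicit Defensive.

Import GRing.Theory.
Local Open Scope ring_scope.
Local Open Scope cat_scope.

(** Call an endomorphism f of A negligible if q (f ⊗ 1) r = 0 for all V,
    q : A ⊗ V -> 1 and r : 1 -> A ⊗ V. Negligible endomorphisms form an ideal
    which is stable under tensor products and partial traces. The theorem says
    that the negligible endomorphisms of X are the nilpotent ones, and that they
    form the kernel of the quantum trace.

    Counting braids. Let t : 1 -> X ⊗ W, q : X ⊗ W -> 1 and h in End(X) satisfy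
    q (h ⊗ 1) t = 1. Closing the last strand of an endomorphism of A ⊗ X with t
    and q is a partial trace. If h sits on the closed strand, the partial trace
    of the identity is the identity, whereas the partial trace of a crossing is a
    zigzag z : X -> X composed with h, because naturality of the braiding lets
    the cup t slide through the crossing. Choose one braid over each of the n!
    permutations, built one strand at a time. Partial traces separate these
    braids, up to terms containing h z h. Therefore, if h z h is negligible, the
    n! braids are linearly independent in End(X^n), for every n
    ([fact_le_dim_End]). Moderate growth forbids this, so h z h is never
    negligible ([snake_not_negligible]).

    Consequences. As k is algebraically closed and X is indecomposable, End(X) is
    local, the sum of k and of a nilpotent ideal J. Suppose that h in J satisfies
    q (h ⊗ 1) t = 1 for some t and q. Then h z h is not negligible either and lies
    in a higher power of J than h; iterating contradicts the nilpotency of J. So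
    every element of J is negligible ([nilpotent_negligible]). Non-negligibility
    of X provides t and q with q t = 1; for h = 1 the zigzag z is not negligible,
    hence not in J, hence invertible. Correcting by its inverse yields one of the
    two zigzag identities between X and W; the other zigzag is then an idempotent
    of W, and its image is a left dual of X ([left_dual_of_snake]). The braiding
    makes it a right dual too ([braided_dual]).

    The trace. The quantum trace is itself of the form f |-> q (f ⊗ 1) r, so it
    vanishes on J. Conversely, duality writes every scalar q r, for
    q : X ⊗ V -> 1 and r : 1 -> X ⊗ V, as the quantum trace of some endomorphism
    ([quantum_trace_nondegenerate]). One of these scalars is nonzero, so the trace
    is not zero on End(X) = k + J; thus the trace of the identity is nonzero and
    the kernel of the trace is J. *)

(** * Bilinearity of composition and of the tensor product *)

Section LinearMap.
Variables (k : fieldType) (V W : lmodType k) (f : V -> W).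
Hypothesis fl : linear f.

Lemma map_lin0 : f 0 = 0.
Proof. by have := fl (-1) 0 0; rewrite scaler0 addr0 scaleN1r addNr. Qed.
Lemma map_linD u v : f (u + v) = f u + f v.
Proof. by rewrite -[u]scale1r fl !scale1r. Qed.
Lemma map_linZ a u : f (a *: u) = a *: f u.
Proof. by rewrite -[a *: u]addr0 fl map_lin0 addr0. Qed.
Lemma map_lin_sum (I : finType) (F : I -> V) :
  f (\sum_i F i) = \sum_i f (F i).
Proof. exact: (big_morph f map_linD map_lin0). Qed.

End LinearMap.

Section Bilinear.
Variables (k : fieldType) (C : linCat k).

Lemma comp0m (X Y Z : C) (f : hom X Y) : (0 : hom Y Z) \oc f = 0.
Proof. exact: (map_lin0 (comp_linear_l _)). Qed.
Lemma compm0 (X Y Z : C) (g : hom Y Z) : g \oc (0 : hom X Y) = 0.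
Proof. exact: (map_lin0 (comp_linear_r _)). Qed.
Lemma compZm (X Y Z : C) (a : k) (g : hom Y Z) (f : hom X Y) :
  (a *: g) \oc f = a *: (g \oc f).
Proof. exact: (map_linZ (comp_linear_l _)). Qed.
Lemma compmZ (X Y Z : C) (a : k) (g : hom Y Z) (f : hom X Y) :
  g \oc (a *: f) = a *: (g \oc f).
Proof. exact: (map_linZ (comp_linear_r _)). Qed.
Lemma compDm (X Y Z : C) (g g' : hom Y Z) (f : hom X Y) :
  (g + g') \oc f = g \oc f + g' \oc f.
Proof. exact: (map_linD (comp_linear_l _)). Qed.
Lemma compmD (X Y Z : C) (g : hom Y Z) (f f' : hom X Y) :
  g \oc (f + f') = g \oc f + g \oc f'.
Proof. exact: (map_linD (comp_linear_r _)). Qed.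
Lemma comp_suml (X Y Z : C) (I : finType) (g : I -> hom Y Z) (f : hom X Y) :
  (\sum_i g i) \oc f = \sum_i (g i \oc f).
Proof. exact: (map_lin_sum (comp_linear_l _)). Qed.
Lemma comp_sumr (X Y Z : C) (I : finType) (g : hom Y Z) (f : I -> hom X Y) :
  g \oc (\sum_i f i) = \sum_i (g \oc f i).
Proof. exact: (map_lin_sum (comp_linear_r _)). Qed.

(** Composites are kept nested to the right. [pre2] and [pre3] turn an
    equation between composites into one that rewrites them when they are
    followed, on the right, by a further morphism. *)
Lemma pre2 (X0 X1 X2 X3 : C) (a : hom X1 X2) (b : hom X0 X1) (c : hom X0 X2) :
  a \oc b = c -> forall f : hom X3 X0, a \oc (b \oc f) = c \oc f.
Proof. by move=> <- f; rewrite compmA. Qed.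

Lemma pre3 (X0 X1 X2 X3 X4 : C) (a : hom X2 X3) (b : hom X1 X2) (c : hom X0 X1)
    (d : hom X0 X3) :
  a \oc (b \oc c) = d -> forall f : hom X4 X0, a \oc (b \oc (c \oc f)) = d \oc f.
Proof. by move=> <- f; rewrite !compmA. Qed.

Lemma iso_epi (X Y Z : C) (u : hom X Y) (v : hom Y X) (f g : hom Y Z) :
  u \oc v = idm Y -> f \oc u = g \oc u -> f = g.
Proof. by move=> uv fg; rewrite -[f]compm1 -[g]compm1 -uv !compmA fg. Qed.

Lemma iso_mono (X Y Z : C) (u : hom X Y) (v : hom Y X) (f g : hom Z X) :
  v \oc u = idm X -> u \oc f = u \oc g -> f = g.
Proof. by move=> vu fg; rewrite -[f]comp1m -[g]comp1m -vu -!compmA fg. Qed.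

Lemma inv_uniq (X Y : C) (f : hom X Y) (g g' : hom Y X) :
  g \oc f = idm X -> f \oc g' = idm Y -> g = g'.
Proof. by move=> gf fg'; rewrite -[g]compm1 -fg' compmA gf comp1m. Qed.

End Bilinear.

(** * Coherence in a monoidal category *)

Section Monoidal.
Variables (k : fieldType) (C : monCat k).
Implicit Types A B U V W X Y Z : C.
Local Notation "1" := (unit_obj C) : cat_scope.

Lemma tens0m X X' Y Y' (g : hom Y Y') : (0 : hom X X') \om g = 0.
Proof. exact: (map_lin0 (tensm_linear_l _)). Qed.
Lemma tensZm X X' Y Y' a (f : hom X X') (g : hom Y Y') :
  (a *: f) \om g = a *: (f \om g).
Proof. exact: (map_linZ (tensm_linear_l _)). Qed.
Lemma tensDm X X' Y Y' (f f' : hom X X') (g : hom Y Y') :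
  (f + f') \om g = f \om g + f' \om g.
Proof. exact: (map_linD (tensm_linear_l _)). Qed.
Lemma tens_suml X X' Y Y' (I : finType) (f : I -> hom X X') (g : hom Y Y') :
  (\sum_i f i) \om g = \sum_i (f i \om g).
Proof. exact: (map_lin_sum (tensm_linear_l _)). Qed.

Lemma tens_compl X X' X'' Y (f' : hom X' X'') (f : hom X X') :
  (f' \oc f) \om idm Y = (f' \om idm Y) \oc (f \om idm Y).
Proof. by rewrite -tensm_comp comp1m. Qed.

Lemma tens_compr X Y Y' Y'' (f' : hom Y' Y'') (f : hom Y Y') :
  idm X \om (f' \oc f) = (idm X \om f') \oc (idm X \om f).
Proof. by rewrite -tensm_comp comp1m. Qed.

Lemma tens_swap X X' Y Y' (f : hom X X') (g : hom Y Y') :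
  (f \om idm Y') \oc (idm X \om g) = (idm X' \om g) \oc (f \om idm Y).
Proof. by rewrite -!tensm_comp !comp1m !compm1. Qed.

Lemma assocV_nat X X' Y Y' Z Z' (f : hom X X') (g : hom Y Y') (h : hom Z Z') :
  assocV X' Y' Z' \oc (f \om (g \om h)) = ((f \om g) \om h) \oc assocV X Y Z.
Proof.
apply: (iso_epi (assocVK X Y Z)).
by rewrite -!compmA -assoc_nat assocK compm1 compmA assocK comp1m.
Qed.

Lemma runitV_nat X X' (f : hom X X') :
  runitV X' \oc f = (f \om idm 1) \oc runitV X.
Proof.
apply: (iso_epi (runitVK X)).
by rewrite -!compmA -runit_nat runitK compm1 compmA runitK comp1m.
Qed.

Lemma tens1_faithful X Y (f g : hom X Y) : f \om idm 1 = g \om idm 1 -> f = g.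
Proof.
by move=> fg; apply: (iso_epi (runitVK X)); rewrite -!runit_nat fg.
Qed.

Lemma tens1l_faithful X Y (f g : hom X Y) : idm 1 \om f = idm 1 \om g -> f = g.
Proof.
by move=> fg; apply: (iso_epi (lunitVK X)); rewrite -!lunit_nat fg.
Qed.

Lemma pentagonE W X Y Z :
  (idm W \om assoc X Y Z) \oc (assoc W (X \ox Y) Z \oc (assoc W X Y \om idm Z))
  = assoc W X (Y \ox Z) \oc assoc (W \ox X) Y Z.
Proof. by rewrite compmA pentagon. Qed.

(** Kelly's argument that the two compatibilities of the unit with a tensor
    product follow from the pentagon and the triangle: tensoring with the unit is
    faithful, and after tensoring the claim follows from one pentagon, two
    triangles and naturality. *)
Lemma lunit_tens X Y : lunit (X \ox Y) \oc assoc 1 X Y = lunit X \om idm Y.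
Proof.
apply: tens1l_faithful; rewrite tens_compr.
have uv: assoc 1 (1 \ox X) Y \oc (assoc 1 1 X \om idm Y)
  \oc ((assocV 1 1 X \om idm Y) \oc assocV 1 (1 \ox X) Y) = idm _.
  rewrite -!compmA (pre2 (esym (tens_compl _ _ _))) assocVK tensm_id comp1m.
  by rewrite assocVK.
apply: (iso_epi uv); rewrite -!compmA pentagonE (pre2 (triangle _ _)).
rewrite -(tensm_id X Y) -assoc_nat -triangle tens_compl.
by rewrite (pre2 (assoc_nat _ _ _)) !compmA.
Qed.

Lemma runit_tens X Y : (idm X \om runit Y) \oc assoc X Y 1 = runit (X \ox Y).
Proof.
apply: tens1_faithful; apply: (iso_mono (assocK _ _ _)).
rewrite tens_compl (pre2 (assoc_nat _ _ _)) -compmA -triangle tens_compr.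
rewrite -compmA pentagonE -(triangle (X \ox Y)) -tensm_id.
by rewrite (pre2 (assoc_nat _ _ _)) !compmA.
Qed.

Lemma runitV_tens X Y :
  runitV (X \ox Y) = assocV X Y 1 \oc (idm X \om runitV Y).
Proof.
apply: (@inv_uniq _ _ _ _ (runit (X \ox Y))); first exact: runitK.
rewrite -runit_tens -compmA (pre2 (assocVK _ _ _)) comp1m -tens_compr runitVK.
exact: tensm_id.
Qed.

Lemma triangle_runit X Y :
  (runit X \om idm Y) \oc assocV X 1 Y = idm X \om lunit Y.
Proof. by rewrite -triangle -compmA assocVK compm1. Qed.

Lemma triangle_runitV X Y :
  assocV X 1 Y \oc (idm X \om lunitV Y) = runitV X \om idm Y.
Proof.
apply: (@inv_uniq _ _ _ _ (runit X \om idm Y)); last first.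
  by rewrite -tens_compl runitVK tensm_id.
rewrite -triangle !compmA -[X in X \oc assoc _ _ _]compmA -tens_compr lunitK.
by rewrite tensm_id compm1 assocK.
Qed.

Lemma pentagonV W X Y Z :
  assocV (W \ox X) Y Z \oc assocV W X (Y \ox Z)
  = (assocV W X Y \om idm Z) \oc (assocV W (X \ox Y) Z \oc (idm W \om assocV X Y Z)).
Proof.
apply: (@inv_uniq _ _ _ _ (assoc W X (Y \ox Z) \oc assoc (W \ox X) Y Z)).
  by rewrite -!compmA (pre2 (assocK _ _ _)) comp1m assocK.
rewrite -pentagonE -!compmA.
rewrite (pre2 (esym (tens_compl _ _ _))) assocVK tensm_id comp1m.
by rewrite (pre2 (assocVK _ _ _)) comp1m -tens_compr assocVK tensm_id.
Qed.

(** The pentagon in the form that moves an associator past the rebracketing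
    of its first argument. *)
Lemma pentagon1 W X Y Z :
  assoc (W \ox X) Y Z \oc ((assocV W X Y \om idm Z) \oc assocV W (X \ox Y) Z)
  = assocV W X (Y \ox Z) \oc (idm W \om assoc X Y Z).
Proof.
apply: (iso_mono (assocK W X (Y \ox Z))).
rewrite (pre2 (assocVK _ _ _)) comp1m compmA -pentagonE -!compmA.
rewrite (pre2 (esym (tens_compl _ _ _))) assocVK tensm_id comp1m.
by rewrite assocVK compm1.
Qed.

End Monoidal.

(** * Cups, caps and zigzags as natural families *)

Section CupsAndCaps.
Variables (k : fieldType) (C : monCat k).
Implicit Types A B U V W X Y Z : C.
Local Notation "1" := (unit_obj C) : cat_scope.

(** Strings of objects are bracketed to the left, and a cup is inserted at the
    right end of an arbitrary object A. In this form cups, caps and crossings are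
    natural in A, so that they slide past everything on their left by
    naturality, and later computations are free of associators. The bodies
    are locked because unification would otherwise unfold them when
    reassociating composites. *)
Definition cup X Y (t : hom 1 (X \ox Y)) A : hom A (A \ox X \ox Y) :=
  locked (assocV A X Y \oc ((idm A \om t) \oc runitV A)).

Lemma cupE X Y (t : hom 1 (X \ox Y)) A :
  cup t A = assocV A X Y \oc ((idm A \om t) \oc runitV A).
Proof. by unlock cup. Qed.

Definition cap X Y (q : hom (X \ox Y) 1) A : hom (A \ox X \ox Y) A :=
  locked (runit A \oc ((idm A \om q) \oc assoc A X Y)).

Lemma capE X Y (q : hom (X \ox Y) 1) A :
  cap q A = runit A \oc ((idm A \om q) \oc assoc A X Y).
Proof. by unlock cap. Qed.

Lemma cup_nat X Y (t : hom 1 (X \ox Y)) A B (f : hom A B) :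
  cup t B \oc f = (f \om idm X \om idm Y) \oc cup t A.
Proof.
rewrite !cupE -!compmA runitV_nat (pre2 (esym (tens_swap _ _))) -compmA.
by rewrite -(tensm_id X Y) (pre2 (assocV_nat _ _ _)) -!compmA.
Qed.

Lemma cap_nat X Y (q : hom (X \ox Y) 1) A B (f : hom A B) :
  f \oc cap q A = cap q B \oc (f \om idm X \om idm Y).
Proof.
rewrite !capE -!compmA assoc_nat tensm_id (pre2 (esym (tens_swap _ _))) -compmA.
by rewrite (pre2 (runit_nat _)) -!compmA.
Qed.

Lemma cap_tensm X X' Y Y' (q : hom (X' \ox Y') 1) (f : hom X X') (g : hom Y Y') A :
  cap (q \oc (f \om g)) A = cap q A \oc (idm A \om f \om g).
Proof. by rewrite !capE -!compmA assoc_nat tens_compr -!compmA. Qed.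

Lemma cup_tensm X X' Y Y' (t : hom 1 (X \ox Y)) (f : hom X X') (g : hom Y Y') A :
  cup ((f \om g) \oc t) A = (idm A \om f \om g) \oc cup t A.
Proof. by rewrite !cupE tens_compr -!compmA (pre2 (assocV_nat _ _ _)) -!compmA. Qed.

Lemma cap_cup X Y (q : hom (X \ox Y) 1) (t : hom 1 (X \ox Y)) A :
  cap q A \oc cup t A = runit A \oc ((idm A \om (q \oc t)) \oc runitV A).
Proof.
by rewrite !capE !cupE -!compmA (pre2 (assocVK _ _ _)) comp1m tens_compr -!compmA.
Qed.

(** The two zigzags are defined by the expressions of the zigzag identities, for
    arbitrary ends U and V, so that a duality is a pair with both zigzags equal
    to identities, and transposes of morphisms are zigzags as well. *)
Definition snakeL U X V (q : hom (U \ox X) 1) (r : hom 1 (X \ox V)) : hom U V :=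
  locked (lunit V \oc (q \om idm V) \oc assocV U X V \oc (idm U \om r)
    \oc runitV U).

Lemma snakeLE U X V (q : hom (U \ox X) 1) (r : hom 1 (X \ox V)) :
  snakeL q r = lunit V \oc (q \om idm V) \oc assocV U X V \oc (idm U \om r)
    \oc runitV U.
Proof. by unlock snakeL. Qed.

Definition snakeR V X U (t : hom 1 (U \ox X)) (q : hom (X \ox V) 1) : hom V U :=
  locked (runit U \oc (idm U \om q) \oc assoc U X V \oc (t \om idm V)
    \oc lunitV V).

Lemma snakeRE V X U (t : hom 1 (U \ox X)) (q : hom (X \ox V) 1) :
  snakeR t q = runit U \oc (idm U \om q) \oc assoc U X V \oc (t \om idm V)
    \oc lunitV V.
Proof. by unlock snakeR. Qed.

(** Pentagon and unit coherence: a cup next to A ⊗ B is A tensored with a cup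
    next to B. *)
Lemma cup_tens X Y (t : hom 1 (X \ox Y)) A B :
  cup t (A \ox B) = (assocV A B X \om idm Y) \oc
    (assocV A (B \ox X) Y \oc (idm A \om cup t B)).
Proof.
rewrite {1}cupE runitV_tens -(tensm_id A B) (pre2 (esym (assocV_nat _ _ _))).
by rewrite -!compmA (pre2 (pentagonV _ _ _ _)) cupE -!compmA -!tens_compr.
Qed.

Lemma cap_tens X Y (q : hom (X \ox Y) 1) A B :
  cap q (A \ox B) = (idm A \om cap q B) \oc
    (assoc A (B \ox X) Y \oc (assoc A B X \om idm Y)).
Proof.
rewrite {1}capE -runit_tens -!compmA -(tensm_id A B) (pre2 (assoc_nat _ _ _)).
by rewrite -!compmA -pentagonE !capE !tens_compr !compmA.
Qed.

(** The zigzag formed by the natural cups and caps next to A is A tensored with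
    a single endomorphism; this is what lets all computations with zigzags take
    place inside natural families. *)
Lemma snakeL_tens U X V (q : hom (U \ox X) 1) (r : hom 1 (X \ox V)) A :
  (cap q A \om idm V) \oc cup r (A \ox U) = idm A \om snakeL q r.
Proof.
rewrite cup_tens (pre2 (esym (tens_compl _ _ _))) {1}capE -!compmA.
rewrite assocVK compm1 tens_compl -!compmA (pre2 (esym (assocV_nat _ _ _))).
rewrite -!compmA (pre2 (triangle_runit _ _)) -!tens_compr.
by rewrite !cupE !snakeLE !compmA.
Qed.

Lemma snakeR_tens V X U (t : hom 1 (U \ox X)) (q : hom (X \ox V) 1) A :
  cap q (A \ox U) \oc (cup t A \om idm V) = idm A \om snakeR t q.
Proof.
rewrite cap_tens -!compmA -tens_compl {1}cupE (pre2 (assocVK _ _ _)) comp1m.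
rewrite tens_compl (pre2 (assoc_nat _ _ _)) -compmA.
have -> : assoc A 1 V \oc (runitV A \om idm V) = idm A \om lunitV V.
  by rewrite -triangle_runitV compmA assocVK comp1m.
by rewrite -!tens_compr !capE !snakeRE -!compmA.
Qed.

End CupsAndCaps.

(** * Braidings, and sliding cups and caps through crossings *)

Section Braided.
Variables (k : fieldType) (C : braidedCat k).
Implicit Types A B U V W X Y Z : C.
Local Notation "1" := (unit_obj C) : cat_scope.

Lemma braidV_nat X X' Y Y' (f : hom X X') (g : hom Y Y') :
  braidV X' Y' \oc (g \om f) = (f \om g) \oc braidV X Y.
Proof.
apply: (iso_epi (braidVK X Y)).
by rewrite -!compmA -braid_nat braidK compm1 compmA braidK comp1m.
Qed.

Lemma hexagonE X Y Z :
  (idm Y \om braid X Z) \oc (assoc Y X Z \oc (braid X Y \om idm Z))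
  = assoc Y Z X \oc (braid X (Y \ox Z) \oc assoc X Y Z).
Proof. by rewrite !compmA hexagon_l. Qed.

(** The case Y = Z = 1 of the hexagon, with one factor cancelled. *)
Lemma braid_unit X : lunit X \oc braid X 1 = runit X.
Proof.
apply: tens1_faithful; apply: (iso_mono (braidK X 1)).
rewrite tens_compl -lunit_tens -[in LHS]compmA compmA -lunit_nat -!compmA.
rewrite hexagonE (pre2 (lunit_tens _ _)).
by rewrite (pre2 (esym (braid_nat _ _))) -compmA triangle.
Qed.

Definition br X Y A : hom (A \ox X \ox Y) (A \ox Y \ox X) :=
  locked (assocV A Y X \oc ((idm A \om braid X Y) \oc assoc A X Y)).

Lemma brE X Y A :
  br X Y A = assocV A Y X \oc ((idm A \om braid X Y) \oc assoc A X Y).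
Proof. by unlock br. Qed.

Definition brV X Y A : hom (A \ox Y \ox X) (A \ox X \ox Y) :=
  locked (assocV A X Y \oc ((idm A \om braidV X Y) \oc assoc A Y X)).

Lemma brVE X Y A :
  brV X Y A = assocV A X Y \oc ((idm A \om braidV X Y) \oc assoc A Y X).
Proof. by unlock brV. Qed.

Lemma brK X Y A : brV X Y A \oc br X Y A = idm _.
Proof.
rewrite !brE !brVE -!compmA (pre2 (assocVK _ _ _)) comp1m.
by rewrite (pre2 (esym (tens_compr _ _ _))) braidK tensm_id comp1m assocK.
Qed.

Lemma brVK X Y A : br X Y A \oc brV X Y A = idm _.
Proof.
rewrite !brE !brVE -!compmA (pre2 (assocVK _ _ _)) comp1m.
by rewrite (pre2 (esym (tens_compr _ _ _))) braidVK tensm_id comp1m assocK.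
Qed.

Lemma br_nat X X' Y Y' A B (f : hom A B) (g : hom X X') (h : hom Y Y') :
  br X' Y' B \oc (f \om g \om h) = (f \om h \om g) \oc br X Y A.
Proof.
rewrite !brE -!compmA assoc_nat [RHS]compmA -assocV_nat -!compmA.
by rewrite (pre2 (esym (tensm_comp _ _ _ _))) (pre2 (esym (tensm_comp _ _ _ _)))
           braid_nat comp1m compm1.
Qed.

Lemma cap_braid X Y (q : hom (Y \ox X) 1) A :
  cap (q \oc braid X Y) A = cap q A \oc br X Y A.
Proof.
by rewrite !capE !brE -!compmA (pre2 (assocVK _ _ _)) comp1m tens_compr -!compmA.
Qed.

Lemma cap_braidV X Y (q : hom (X \ox Y) 1) A :
  cap (q \oc braidV X Y) A = cap q A \oc brV X Y A.
Proof.
by rewrite !capE !brVE -!compmA (pre2 (assocVK _ _ _)) comp1m tens_compr -!compmA.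
Qed.

Lemma cup_braidV X Y (t : hom 1 (Y \ox X)) A :
  cup (braidV X Y \oc t) A = brV X Y A \oc cup t A.
Proof.
by rewrite !cupE !brVE -!compmA (pre2 (assocVK _ _ _)) comp1m tens_compr -!compmA.
Qed.

End Braided.

Section Slides.
Variables (k : fieldType) (C : braidedCat k).
Implicit Types A B U V W X Y Z : C.
Local Notation "1" := (unit_obj C) : cat_scope.

Lemma braid_runitV X : braid X 1 \oc runitV X = lunitV X.
Proof.
apply: (iso_mono (lunitK X)).
by rewrite compmA braid_unit runitVK lunitVK.
Qed.

Lemma br_assocV X Y A :
  br X Y A \oc assocV A X Y = assocV A Y X \oc (idm A \om braid X Y).
Proof. by rewrite !brE -!compmA assocVK compm1. Qed.

(** The hexagon for left bracketed strings: X crosses Y and then Z as it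
    crosses the single object Y ⊗ Z. Both sliding lemmas below combine it with
    naturality of the braiding in Y ⊗ Z. *)
Lemma br_hexagon X Y Z A :
  br X Z (A \ox Y) \oc ((br X Y A \om idm Z) \oc
    ((assocV A X Y \om idm Z) \oc assocV A (X \ox Y) Z))
  = (assocV A Y Z \om idm X) \oc (assocV A (Y \ox Z) X \oc
      (idm A \om (braid X (Y \ox Z) \oc assoc X Y Z))).
Proof.
rewrite (pre2 (esym (tens_compl _ _ _))) br_assocV tens_compl -!compmA.
rewrite -assocV_nat {1}brE -!compmA (pre3 (pentagon1 _ _ _ _)) -(tensm_id A Y).
rewrite -!compmA (pre2 (esym (assocV_nat _ _ _))) -!compmA -!tens_compr hexagonE.
rewrite (pre2 (pentagonV _ _ _ _)) -!compmA -!tens_compr.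
by rewrite (pre2 (assocK _ _ _)) comp1m.
Qed.

(** A cup can be pulled through a strand X: as the braiding is natural and
    trivial with the unit, X crossing both ends of a cup on its right is the cup
    on its left. *)
Lemma slide_cup X Y Z (t : hom 1 (Y \ox Z)) A :
  br X Z (A \ox Y) \oc ((br X Y A \om idm Z) \oc cup t (A \ox X))
  = cup t A \om idm X.
Proof.
rewrite cup_tens.
have := congr1 (fun f => f \oc (idm A \om cup t X)) (br_hexagon X Y Z A).
rewrite -!compmA => ->; rewrite -!tens_compr {1}cupE -compmA.
rewrite (pre2 (assocVK _ _ _)) comp1m (pre2 (braid_nat _ _)) -compmA.
rewrite braid_runitV tens_compr (pre2 (assocV_nat _ _ _)) -!compmA.
by rewrite triangle_runitV cupE -!tens_compl.
Qed.

Lemma slide_cap X Y Z (q : hom (Y \ox Z) 1) A :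
  (cap q A \om idm X) \oc (br X Z (A \ox Y) \oc (br X Y A \om idm Z))
  = cap q (A \ox X).
Proof.
have uv : ((assocV A X Y \om idm Z) \oc assocV A (X \ox Y) Z)
    \oc (assoc A (X \ox Y) Z \oc (assoc A X Y \om idm Z)) = idm _.
  by rewrite -!compmA (pre2 (assocK _ _ _)) comp1m -tens_compl assocK tensm_id.
apply: (iso_epi uv); rewrite -!compmA br_hexagon cap_tens -!compmA.
rewrite (pre2 (esym (tens_compl _ (assoc A X Y) _))) assocVK tensm_id comp1m.
rewrite assocVK compm1 (pre2 (esym (tens_compl _ _ _))) !capE -!compmA.
rewrite assocVK compm1.
rewrite tens_compl -compmA (pre2 (esym (assocV_nat _ _ _))) -compmA.
rewrite (pre2 (triangle_runit _ _)) -!tens_compr.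
by rewrite (pre2 (esym (braid_nat _ _))) -compmA (pre2 (braid_unit _)).
Qed.

End Slides.

Section Mirror.
Variables (k : fieldType) (C : braidedCat k).

Lemma mirror_hexagon_l (X Y Z : C) :
  assoc Y Z X \oc braidV (Y \ox Z) X \oc assoc X Y Z
  = (idm Y \om braidV Z X) \oc assoc Y X Z \oc (braidV Y X \om idm Z).
Proof.
apply: (@inv_uniq _ _ _ _
  (assocV X Y Z \oc braid (Y \ox Z) X \oc assocV Y Z X)).
  rewrite -!compmA (pre2 (assocVK _ _ _)) comp1m.
  by rewrite (pre2 (braidK _ _)) comp1m assocVK.
rewrite hexagon_r -!compmA.
rewrite (pre2 (esym (tens_compr _ _ _))) braidVK tensm_id comp1m.
by rewrite (pre2 (assocK _ _ _)) comp1m -tens_compl braidVK tensm_id.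
Qed.

Lemma mirror_hexagon_r (X Y Z : C) :
  assocV Z X Y \oc braidV Z (X \ox Y) \oc assocV X Y Z
  = (braidV Z X \om idm Y) \oc assocV X Z Y \oc (idm X \om braidV Z Y).
Proof.
apply: (@inv_uniq _ _ _ _
  (assoc X Y Z \oc braid Z (X \ox Y) \oc assoc Z X Y)).
  rewrite -!compmA (pre2 (assocK _ _ _)) comp1m.
  by rewrite (pre2 (braidK _ _)) comp1m assocK.
rewrite hexagon_l -!compmA.
rewrite (pre2 (esym (tens_compl _ _ _))) braidVK tensm_id comp1m.
by rewrite (pre2 (assocVK _ _ _)) comp1m -tens_compr braidVK tensm_id.
Qed.

(** The inverse braiding is again a braiding. This provides the sliding lemmas
    for the opposite crossings. *)
Definition mirror : braidedCat k :=
  @BraidedCat k C (fun X Y => braidV Y X) (fun X Y => braid Y X)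
    (fun X Y => braidVK Y X) (fun X Y => braidK Y X)
    (fun X X' Y Y' f g => braidV_nat g f)
    mirror_hexagon_l mirror_hexagon_r.

Local Notation "1" := (unit_obj C) : cat_scope.

Lemma mirror_slide_cup (X Y Z : C) (t : hom 1 (Y \ox Z)) (A : C) :
  brV Z X (A \ox Y) \oc ((brV Y X A \om idm Z) \oc cup t (A \ox X))
  = cup t A \om idm X.
Proof. exact: (@slide_cup k mirror). Qed.

Lemma mirror_slide_cap (X Y Z : C) (q : hom (Y \ox Z) 1) (A : C) :
  (cap q A \om idm X) \oc (brV Z X (A \ox Y) \oc (brV Y X A \om idm Z))
  = cap q (A \ox X).
Proof. exact: (@slide_cap k mirror). Qed.

End Mirror.

(** * The partial trace over the last strand *)

Section PartialTrace.
Variables (k : fieldType) (C : braidedCat k).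
Implicit Types A B U V Y Z : C.
Local Notation "1" := (unit_obj C) : cat_scope.
Variables (X W : C) (t : hom 1 (X \ox W)) (q : hom (X \ox W) 1).

Definition ptrace A B (f : hom (A \ox X) (B \ox X)) : hom A B :=
  locked (cap q B \oc ((f \om idm W) \oc cup t A)).

Lemma ptraceE A B (f : hom (A \ox X) (B \ox X)) :
  ptrace f = cap q B \oc ((f \om idm W) \oc cup t A).
Proof. by unlock ptrace. Qed.

Lemma ptrace_compl A B B' (g : hom B B') (f : hom (A \ox X) (B \ox X)) :
  ptrace ((g \om idm X) \oc f) = g \oc ptrace f.
Proof.
by rewrite !ptraceE tens_compl -!compmA [RHS]compmA cap_nat -!compmA.
Qed.

Lemma ptrace_compr A A' B (f : hom (A \ox X) (B \ox X)) (g : hom A' A) :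
  ptrace (f \oc (g \om idm X)) = ptrace f \oc g.
Proof. by rewrite !ptraceE tens_compl -!compmA -cup_nat. Qed.

Lemma ptrace_sum A B (I : finType) (f : I -> hom (A \ox X) (B \ox X)) :
  ptrace (\sum_i f i) = \sum_i ptrace (f i).
Proof.
rewrite ptraceE tens_suml comp_suml comp_sumr.
by apply: eq_bigr => i _; rewrite ptraceE.
Qed.

Lemma ptrace_tens (h : End X) A :
  q \oc ((h \om idm W) \oc t) = idm 1 -> ptrace (idm A \om h) = idm A.
Proof.
by move=> qht; rewrite ptraceE -cup_tensm cap_cup qht tensm_id comp1m runitVK.
Qed.

(** The two crossings let y act on A and on the closed strand, with a strand X
    between them. Sliding the cup and the cap of the closure through that strand
    cancels both crossings, and the closure takes place next to A. *)
Lemma ptrace_conj A B (y : hom (A \ox X) (B \ox X)) :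
  ptrace (brV X X B \oc ((y \om idm X) \oc br X X A)) = ptrace y \om idm X.
Proof.
have cup_br : (br X X A \om idm W) \oc cup t (A \ox X)
    = brV X W (A \ox X) \oc (cup t A \om idm X).
  by rewrite -(slide_cup X) compmA brK comp1m.
have cap_br : cap q (B \ox X) \oc (brV X X B \om idm W)
    = (cap q B \om idm X) \oc br X W (B \ox X).
  rewrite -(slide_cap X) -!compmA -tens_compl brVK tensm_id.
  by rewrite compm1.
rewrite !ptraceE !tens_compl -!compmA cup_br (pre2 cap_br) -!compmA.
have br_y : br X W (B \ox X) \oc ((y \om idm X) \om idm W)
    = ((y \om idm W) \om idm X) \oc br X W (A \ox X) by apply: br_nat.
by rewrite (pre2 br_y) -compmA (pre2 (brVK _ _ _)) comp1m.
Qed.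

(** Closing one end of a crossing: after the cup has slid through the crossing,
    only one inverse crossing remains, and it merges with the cap. *)
Lemma ptrace_br A :
  ptrace (br X X A) = idm A \om snakeR t (q \oc braidV X W).
Proof.
rewrite ptraceE -snakeR_tens cap_braidV -compmA; congr (_ \oc _).
by rewrite -(slide_cup X) (pre2 (brK _ _ _)) comp1m.
Qed.

End PartialTrace.

(** * Negligible endomorphisms *)

Section Negligible.
Variables (k : fieldType) (C : braidedCat k).
Implicit Types A B U V Y Z : C.
Local Notation "1" := (unit_obj C) : cat_scope.

Definition negligible A (f : End A) : Prop :=
  forall V (q : hom (A \ox V) 1) (r : hom 1 (A \ox V)),
    q \oc ((f \om idm V) \oc r) = 0.

Lemma negligible_comp A B (g : hom A B) (f : End A) (g' : hom B A) :
  negligible f -> negligible (g \oc (f \oc g')).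
Proof.
move=> nf V q r; rewrite !tens_compl -!compmA.
by have := nf V (q \oc (g \om idm V)) ((g' \om idm V) \oc r); rewrite -!compmA.
Qed.

Lemma negligible_compl A (g f : End A) : negligible f -> negligible (g \oc f).
Proof. by move=> /(negligible_comp g (idm A)); rewrite compm1. Qed.

Lemma negligible_compr A (f g : End A) : negligible f -> negligible (f \oc g).
Proof. by move=> /(negligible_comp (idm A) g); rewrite comp1m. Qed.

Lemma negligibleD A (f g : End A) :
  negligible f -> negligible g -> negligible (f + g).
Proof. by move=> nf ng V q r; rewrite tensDm compDm compmD nf ng addr0. Qed.

Lemma negligible0 A : negligible (0 : End A).
Proof. by move=> V q r; rewrite tens0m comp0m compm0. Qed.

Lemma negligible_sum A (I : finType) (P : pred I) (f : I -> End A) :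
  (forall i, P i -> negligible (f i)) -> negligible (\sum_(i | P i) f i).
Proof.
by move=> nf; apply: (big_ind (@negligible A)) => //;
  [exact: negligible0 | exact: negligibleD].
Qed.

Lemma negligible_tensl A B (f : End A) (g : End B) :
  negligible f -> negligible (f \om g).
Proof.
move=> nf; rewrite -[f]compm1 -[g]comp1m tensm_comp; apply: negligible_compr.
move=> V q r.
have := nf _ (q \oc assocV A B V) (assoc A B V \oc r).
rewrite -!compmA -tensm_id (pre2 (assocV_nat _ _ _)).
by rewrite -!compmA (pre2 (assocK _ _ _)) comp1m.
Qed.

(** The definition is not symmetric; conjugation by the braiding reduces this
    to [negligible_tensl]. *)
Lemma negligible_tensr A B (f : End A) (g : End B) :
  negligible g -> negligible (f \om g).
Proof.
move=> ng; have := negligible_comp (braid B A) (braidV B A) (negligible_tensl f ng).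
by rewrite compmA braid_nat -compmA braidVK compm1.
Qed.

Lemma negligible_ptrace X W (t : hom 1 (X \ox W)) (q : hom (X \ox W) 1) A
    (f : End (A \ox X)) :
  negligible f -> negligible (ptrace t q f).
Proof.
move=> nf V p r.
have := nf (W \ox V)
  (p \oc ((cap q A \om idm V) \oc assocV (A \ox X) W V))
  (assoc (A \ox X) W V \oc ((cup t A \om idm V) \oc r)).
rewrite -!compmA -tensm_id (pre2 (assocV_nat _ _ _)).
rewrite -!compmA (pre2 (assocK _ _ _)) comp1m.
by rewrite ptraceE !tens_compl -!compmA.
Qed.

End Negligible.

(** * Linear independence of n! braids *)

Section Growth.
Variables (k : fieldType) (C : braidedCat k).
Local Notation "1" := (unit_obj C) : cat_scope.
Variables (X W : C) (t : hom 1 (X \ox W)) (q : hom (X \ox W) 1) (h : End X).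

Fixpoint tens_pow_endo n : End (tens_pow X n) :=
  if n is m.+1 then tens_pow_endo m \om h else idm 1.

(** The braid that moves the last of n + 1 strands j places to the left; these
    braids represent the cosets of the permutations of n letters in those of
    n + 1 letters. For j > n the move stops at the left end. *)
Fixpoint strand n (j : nat) : End (tens_pow X n \ox X) :=
  match n return End (tens_pow X n \ox X) with
  | 0 => idm _
  | m.+1 => if j is i.+1 then (strand m i \om idm X) \oc br X X (tens_pow X m)
            else idm _
  end.

Fixpoint strandV n (j : nat) : End (tens_pow X n \ox X) :=
  match n return End (tens_pow X n \ox X) with
  | 0 => idm _
  | m.+1 => if j is i.+1 then brV X X (tens_pow X m) \oc (strandV m i \om idm X)
            else idm _
  end.

(** A permutation of n + 1 letters is the position of the last letter together
    with a permutation of the n others. *)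
Fixpoint braid_index n : finType :=
  if n is m.+1 then ('I_m.+1 * braid_index m)%type else unit.

Fixpoint braid_word n : braid_index n -> End (tens_pow X n) :=
  match n return braid_index n -> End (tens_pow X n) with
  | 0 => fun _ => idm 1
  | m.+1 => fun w => strand m w.1 \oc (@braid_word m w.2 \om idm X)
  end.

Lemma card_braid_index n : #|braid_index n| = n`!.
Proof.
elim: n => [|n IHn]; first by rewrite card_unit.
by rewrite /= card_prod card_ord IHn.
Qed.

Lemma strand_comm n j :
  strand n j \oc tens_pow_endo n.+1 = tens_pow_endo n.+1 \oc strand n j.
Proof.
elim: n j => [|n IHn] [|j]; rewrite ?compm1 ?comp1m //=.
rewrite -compmA br_nat compmA -tensm_comp comp1m.
have /= -> := IHn j.
by rewrite compmA -tensm_comp compm1.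
Qed.

Lemma braid_word_comm n (w : braid_index n) :
  braid_word w \oc tens_pow_endo n = tens_pow_endo n \oc braid_word w.
Proof.
elim: n w => [|n IHn] w //=.
have /= sc := strand_comm n w.1.
by rewrite compmA -sc -!compmA -!tensm_comp IHn compm1 comp1m.
Qed.

Hypothesis qht : q \oc ((h \om idm W) \oc t) = idm 1.
Let z : End X := snakeR t (q \oc braidV X W).
Hypothesis hzh : negligible (h \oc (z \oc h)).

(** The partial trace pairs coset representatives; the family of representatives
    is independent because this pairing is unitriangular up to negligible terms. *)
Definition strand_pairing n i j : End (tens_pow X n) :=
  ptrace t q (strandV n i \oc (strand n j \oc (idm _ \om h))).

(** Both braids start with the same crossing, so that [ptrace_conj] reduces the
    pairing to one strand less. *)
Lemma strand_pairingSS n i j :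
  strand_pairing n.+1 i.+1 j.+1 = strand_pairing n i j \om idm X.
Proof.
rewrite /strand_pairing /= -ptrace_conj; congr (ptrace _ _ _).
rewrite -!compmA; congr (_ \oc _).
rewrite -(tensm_id (tens_pow X n) X) br_nat (pre2 (esym (tens_compl _ _ _))).
by rewrite (pre2 (esym (tens_compl _ _ _))) -!compmA.
Qed.

Lemma strand_pairing_diag n i : strand_pairing n i i = idm _.
Proof.
elim: n i => [|n IHn] [|i]; last by rewrite strand_pairingSS IHn tensm_id.
all: by rewrite /strand_pairing /= !comp1m ptrace_tens.
Qed.

(** By [strand_pairingSS] only i = 0 needs an argument. Then one crossing is
    closed, which produces z h on the last of the remaining strands; the second
    factor h on that strand completes it to h z h. *)
Lemma strand_pairing_lt n i j : (i < j <= n)%N ->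
  negligible (strand_pairing n i j \oc tens_pow_endo n).
Proof.
elim: n i j => [|n IHn] [|i] [|j] //=; first by rewrite ltn0 andbF.
  move=> _; rewrite /strand_pairing /= comp1m -(tensm_id (tens_pow X n) X).
  rewrite -compmA br_nat !ptrace_compl ptrace_br -!compmA -!tensm_comp !comp1m.
  by apply/negligible_compl/negligible_tensr.
rewrite !ltnS => ij; rewrite strand_pairingSS -tensm_comp comp1m.
exact/negligible_tensl/IHn.
Qed.

Hypothesis unit_neq0 : idm 1 != 0 :> End 1.

(** Every strand carries a copy of h. Copies of h commute with the braids, so one
    of them is available on the closed strand, and another one on the strand
    that the closure turns into a zigzag. The pairing being only triangular, the
    coefficients are shown to vanish coset by coset. *)
Lemma braid_word_independent n (a : braid_index n -> k) :
  negligible ((\sum_w a w *: braid_word w) \oc tens_pow_endo n) ->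
  forall w, a w = 0.
Proof.
elim: n a => [|n IHn] a /= nf.
  case; have := nf 1 (lunit 1) (lunitV 1).
  rewrite (bigD1 tt) //= big1 ?addr0; last by case.
  rewrite compm1 tensZm compZm compmZ tensm_id comp1m lunitVK.
  by move/eqP; rewrite scaler_eq0 (negPf unit_neq0) orbF => /eqP.
pose x (j : 'I_n.+1) := \sum_w a (j, w) *: braid_word w.
have fE : \sum_(w : braid_index n.+1) a w *:
      (strand n w.1 \oc (braid_word w.2 \om idm X))
    = \sum_(j < n.+1) strand n j \oc (x j \om idm X).
  pose F (j : 'I_n.+1) (w : braid_index n) :=
    a (j, w) *: (strand n j \oc (braid_word w \om idm X)).
  transitivity (\sum_(j < n.+1) \sum_w F j w).
    by rewrite pair_bigA; apply: eq_bigr => -[].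
  apply: eq_bigr => j _; rewrite tens_suml comp_sumr; apply: eq_bigr => w _.
  by rewrite tensZm compmZ.
have x_comm j : x j \oc tens_pow_endo n = tens_pow_endo n \oc x j.
  rewrite comp_suml comp_sumr; apply: eq_bigr => w _.
  by rewrite compZm compmZ braid_word_comm.
suff a0 m (j : 'I_n.+1) : j = m :> nat -> forall w, a (j, w) = 0.
  by move=> [j w]; apply: (a0 j j).
elim/ltn_ind: m j => m IHm j jm.
apply: (IHn (fun w => a (j, w))); rewrite -/(x j).
have := negligible_ptrace t q (negligible_compl (strandV n j) nf).
have -> : ptrace t q (strandV n j \oc ((\sum_(w : braid_index n.+1) a w *:
      (strand n w.1 \oc (braid_word w.2 \om idm X))) \oc (tens_pow_endo n \om h)))
    = \sum_(i < n.+1) strand_pairing n j i \oc (x i \oc tens_pow_endo n).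
  rewrite fE comp_suml comp_sumr ptrace_sum; apply: eq_bigr => i _.
  rewrite -ptrace_compr; congr (ptrace _ _ _).
  by rewrite -!compmA -!tensm_comp !comp1m compm1.
(* terms before j vanish by induction, terms after j pair negligibly *)
rewrite (bigD1 j) //= strand_pairing_diag comp1m => nsum.
suff nrest : negligible (\sum_(i < n.+1 | i != j) strand_pairing n j i \oc
    (x i \oc tens_pow_endo n)).
  set u := x j \oc _ in nsum *; set v := \sum_(i | i != j) _ in nsum nrest.
  by move=> V p r; have := nsum V p r; rewrite tensDm compDm compmD nrest addr0.
apply: negligible_sum => i i_neq_j.
have [ij|ji] := ltnP i j.
  have -> : x i = 0.
    by rewrite /x big1 // => w _; rewrite (IHm i) -?jm // scale0r.
  by rewrite comp0m compm0; apply: negligible0.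
rewrite x_comm compmA; apply/negligible_compr/strand_pairing_lt.
by rewrite ltn_neqAle ji eq_sym i_neq_j -ltnS ltn_ord.
Qed.

Lemma fact_le_dim_End n : (n`! <= \dim {: End (tens_pow X n)})%N.
Proof.
pose s := [tuple braid_word (enum_val i) | i < #|braid_index n|].
have s_free : free s.
  apply/freeP => a sum0 i.
  suff a0 : forall w : braid_index n, a (enum_rank w) = 0.
    by rewrite -(enum_valK i).
  apply: (braid_word_independent (n := n)).
  suff -> : \sum_w a (enum_rank w) *: braid_word w = 0.
    by rewrite comp0m; apply: negligible0.
  rewrite -[RHS]sum0 [RHS](reindex (@enum_rank (braid_index n))) /=; last first.
    exact/onW_bij/enum_rank_bij.
  apply: eq_bigr => w _; rewrite (nth_map (enum_rank w)) ?size_enum_ord //.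
  by rewrite nth_ord_enum enum_rankK.
rewrite -card_braid_index -(size_tuple s) -(eqP s_free).
exact/dimvS/subvf.
Qed.

End Growth.

(** * Finite dimensional algebras without nontrivial idempotents *)

Section LocalAlgebra.
Variables (k : closedFieldType) (L : falgType k).
Implicit Types f g u v : L.
Hypothesis idem_trivial : forall e : L, e * e = e -> e = 0 \/ e = 1.

Definition horner_coords g (v : 'rV[k]_(\dim {: L}).+1) : L :=
  horner_alg g (rVpoly v).

Lemma horner_coords_linear g : linear (horner_coords g).
Proof.
move=> a u v; rewrite /horner_coords [rVpoly _]linearP /= rmorphD /= -mul_polyC.
by rewrite rmorphM /= horner_algC mulr_algl.
Qed.

HB.instance Definition _ g := GRing.isLinear.Build k _ L _ (horner_coords g)
  (horner_coords_linear g).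

(** Evaluation at g cannot be injective on polynomials of degree at most the
    dimension of L. *)
Lemma annihilating_poly g : exists2 p : {poly k}, p != 0 & horner_alg g p = 0.
Proof.
pose ev := linfun (horner_coords g).
have : lker ev != 0%VS.
  apply/eqP => ker0; have := limg_ker_dim ev fullv.
  rewrite ker0 capv0 dimv0 add0n => dimE.
  have := dimvS (subvf (limg ev)).
  by rewrite dimE [X in (X <= _)%N]dimvf /dim /= mul1n ltnn.
rewrite -vpick0 => nz; exists (rVpoly (vpick (lker ev))).
  by apply: contra_neq nz => p0; rewrite -[LHS]rVpolyK p0 linear0.
by have := memv_pick (lker ev); rewrite memv_ker lfunE => /eqP.
Qed.

(** Write an annihilating polynomial as r X^m with r(0) nonzero. A Bezout
    relation between r and X^(m+1) splits 1 into two orthogonal idempotents; one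
    of them vanishes, which makes g invertible or nilpotent. *)
Lemma nonunit_nilpotent g : g \isn't a GRing.unit -> exists n, g ^+ n = 0.
Proof.
move=> g_nonunit; have [p p_neq0 pg0] := annihilating_poly g.
have [m [r]] := multiplicity_XsubC p 0; rewrite p_neq0 /= subr0 => r0 pE.
have : coprimep r ('X ^+ m.+1).
  by apply: coprimep_expr; rewrite -['X]subr0 coprimep_XsubC.
case/Bezout_eq1_coprimepP=> -[u v] /= uv1.
pose ev : {rmorphism {poly k} -> L} := horner_alg g.
have evX : ev 'X = g by apply: horner_algX.
have ev1 : ev (u * r) + ev (v * 'X ^+ m.+1) = 1 by rewrite -rmorphD uv1 rmorph1.
have ev_rX w : ev (w * (r * 'X ^+ m)) = 0 by rewrite rmorphM -pE /= pg0 mulr0.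
pose e := ev (v * 'X ^+ m.+1).
have : e * e = e.
  apply/eqP; rewrite -subr_eq0 -[X in _ - X]mulr1 -mulrBr -ev1 opprD addrCA subrr.
  rewrite addr0 mulrN oppr_eq0 -rmorphM /=.
  have -> : v * 'X ^+ m.+1 * (u * r) = (v * 'X * u) * (r * 'X ^+ m).
    by rewrite exprS -!mulrA; congr (_ * (_ * _)); rewrite mulrC -mulrA.
  by rewrite ev_rX.
case/idem_trivial=> eE; rewrite -/e eE ?addr0 in ev1.
  exists m; rewrite -evX -rmorphXn -[LHS]mul1r -ev1 -rmorphM /=.
  by rewrite -mulrA ev_rX.
case/negP: g_nonunit; apply/unitrP; exists (ev (v * 'X ^+ m)).
rewrite -evX -!rmorphM [X in _ /\ ev X = _]mulrC -mulrA -exprSr.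
by split.
Qed.

Lemma nilpotent_nonunit g n : g ^+ n = 0 -> g \isn't a GRing.unit.
Proof.
move=> gn0; apply/negP => /(unitrX n); rewrite gn0 unitr0 //.
Qed.

Lemma nonunitMl f g : f \isn't a GRing.unit -> g * f \isn't a GRing.unit.
Proof.
move=> /nonunit_nilpotent[n fn0]; apply/negP => gf_unit.
have [w wf1] : exists w, w * f = 1.
  by exists ((g * f)^-1 * g); rewrite -mulrA mulVr.
have : w ^+ n * f ^+ n = 1.
  elim: n {fn0} => [|n IHn]; first by rewrite mul1r.
  by rewrite exprSr exprS mulrA -[w ^+ n * w * f]mulrA wf1 mulr1.
by move/eqP; rewrite fn0 mulr0 eq_sym oner_eq0.
Qed.

Lemma nonunitMr f g : f \isn't a GRing.unit -> f * g \isn't a GRing.unit.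
Proof.
move=> /nonunit_nilpotent[n fn0]; apply/negP => fg_unit.
have [w fw1] : exists w, f * w = 1.
  by exists (g * (f * g)^-1); rewrite mulrA mulrV.
have : f ^+ n * w ^+ n = 1.
  elim: n {fn0} => [|n IHn]; first by rewrite mul1r.
  by rewrite exprSr exprS mulrA -[f ^+ n * f * w]mulrA fw1 mulr1.
by move/eqP; rewrite fn0 mul0r eq_sym oner_eq0.
Qed.

Lemma unit_1sub f : f \isn't a GRing.unit -> 1 - f \is a GRing.unit.
Proof.
move=> /nonunit_nilpotent[n fn0]; rewrite -opprB unitrN.
have : f ^+ n - 1 \is a GRing.unit by rewrite fn0 sub0r unitrN unitr1.
rewrite subrX1 unitrM_comm; first by case/andP.
apply: commr_sum => i _; apply/commr_sym/commrB; last exact: commr1.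
exact/commr_sym/commrX.
Qed.

Lemma nonunitD f g : f \isn't a GRing.unit -> g \isn't a GRing.unit ->
  f + g \isn't a GRing.unit.
Proof.
move=> fN gN; apply/negP => fg_unit.
have := unit_1sub (nonunitMl (f + g)^-1 fN).
rewrite -(mulVr fg_unit) -mulrBr addrAC subrr add0r => h.
by have := nonunitMl (f + g)^-1 gN; rewrite h.
Qed.

Lemma eigenvalue_exists f : exists a : k, f - a%:A \isn't a GRing.unit.
Proof.
have [p p_neq0] := annihilating_poly f.
have [r ->] := closed_field_poly_normal p.
rewrite -mul_polyC rmorphM /= horner_algC mulr_algl rmorph_prod /= => /eqP.
rewrite scaler_eq0 lead_coef_eq0 (negPf p_neq0) /=.
elim: r => [|a r IHr]; first by rewrite big_nil oner_eq0.
rewrite big_cons; have [fa_unit|fa_nonunit] := boolP (f - a%:A \is a GRing.unit).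
  rewrite rmorphB /= horner_algX horner_algC => h; apply: IHr.
  by rewrite -[X in X == 0](mulKr fa_unit) (eqP h) mulr0.
by exists a.
Qed.

(** The unique eigenvalue of f, chosen as a function of f. *)
Definition residue f : k^o := xchoose (eigenvalue_exists f).

Lemma residueP f : f - (residue f)%:A \isn't a GRing.unit.
Proof. exact: xchooseP (eigenvalue_exists f). Qed.

Lemma residue_uniq f a : f - a%:A \isn't a GRing.unit -> residue f = a.
Proof.
move=> faN; apply/eqP; rewrite -subr_eq0; apply/negP => /negP d_neq0.
have fN : - (f - (residue f)%:A) \isn't a GRing.unit.
  by rewrite unitrN residueP.
have := nonunitD faN fN.
rewrite opprB addrC addrA subrK -scalerBl -[X in X \isn't a _]mulr1.
rewrite -scalerAl mul1r => /negP[].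
by rewrite -unitfE in d_neq0; rewrite scaler_unit ?unitr1.
Qed.

Lemma residue_linear : linear residue.
Proof.
move=> a f g; apply: residue_uniq.
have -> : a *: f + g - (a *: residue f + residue g)%:A
    = a%:A * (f - (residue f)%:A) + (g - (residue g)%:A).
  rewrite scalerDl opprD addrACA; congr (_ + _).
  by rewrite -scalerAl mul1r scalerBr scalerA.
by apply: nonunitD; [apply: nonunitMl|]; apply: residueP.
Qed.

HB.instance Definition _ := GRing.isLinear.Build k L k^o _ residue
  residue_linear.

Definition radical : {vspace L} :=
  lker (linfun residue).

Lemma mem_radical f : (f \in radical) = (f \isn't a GRing.unit).
Proof.
rewrite memv_ker lfunE /=; apply/eqP/idP => [r0|fN].
  by have := residueP f; rewrite r0 scale0r subr0.
by apply: residue_uniq; rewrite scale0r subr0.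
Qed.

Lemma mul_radical (M : {vspace L}) : (radical * (radical * M) <= radical * M)%VS.
Proof.
rewrite prodvA prodvSl //; apply/prodvP => f g.
by rewrite !mem_radical => fN _; apply: nonunitMr.
Qed.

(** Nakayama's lemma by elimination: if x = a x + w with a in the radical, then
    1 - a is invertible and the generator x is redundant. *)
Lemma nakayama (s : seq L) : (<<s>> <= radical * <<s>>)%VS -> <<s>>%VS = 0%VS.
Proof.
elim: s => [|x s IHs]; first by rewrite span_nil.
rewrite span_cons prodvDr subv_add => /andP[xJ sJ].
have xs : x \in (radical * <<s>>)%VS.
  have /memv_addP[y /memv_cosetP[a aJ ->] [w wJ xE]] : x \in
     (radical * <[x]> + radical * <<s>>)%VS by rewrite memvE.
  have a_unit : 1 - a \is a GRing.unit by rewrite unit_1sub -?mem_radical.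
  have -> : x = (1 - a)^-1 * w.
    apply: (canRL (mulKr a_unit)).
    by rewrite mulrBl mul1r {1}xE addrC addKr.
  have /subvP : ({:L} * (radical * <<s>>) <= radical * <<s>>)%VS.
    rewrite prodvA prodvSl //; apply/prodvP => f g _.
    by rewrite !mem_radical; apply: nonunitMl.
  by apply; rewrite memv_mul ?memvf.
have xsub : (<[x]> <= radical * <<s>>)%VS by rewrite -memvE.
have s0 : <<s>>%VS = 0%VS.
  apply: IHs; apply: subv_trans sJ _; rewrite subv_add subvv andbT.
  exact: subv_trans (prodvSr _ xsub) (mul_radical _).
by apply/eqP; rewrite -subv0 s0 addv0; rewrite s0 prodv0 in xsub.
Qed.

(** The powers of the radical decrease strictly until they vanish, by
    [nakayama]. *)
Lemma radical_nilpotent : exists n, (radical ^+ n.+1 = 0)%VS.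
Proof.
have chain n : (radical ^+ n.+1 = 0)%VS
    \/ (\dim (radical ^+ n.+1) + n <= \dim {: L})%N.
  elim: n => [|n [n0|IHn]]; first by right; rewrite addn0 dimvS ?subvf.
    by left; rewrite expvSl n0 prodv0.
  have sub : (radical ^+ n.+2 <= radical ^+ n.+1)%VS.
    by rewrite expvSl [X in (_ * X)%VS]expvSl [X in (_ <= X)%VS]expvSl mul_radical.
  have [le|lt] := leqP (\dim (radical ^+ n.+1)) (\dim (radical ^+ n.+2)).
    left; have /eqP E : (radical ^+ n.+2 == radical ^+ n.+1)%VS.
      by rewrite eqEdim sub.
    have := nakayama (s := vbasis (radical ^+ n.+1)).
    by rewrite (span_basis (vbasisP _)) -expvSl E; apply.
  by right; apply: leq_trans IHn; rewrite addnS -addSn leq_add2r.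
have [n0|] := chain (\dim {: L}); first by exists (\dim {: L}).
rewrite -[X in (_ <= X)%N]add0n leq_add2r leqn0 dimv_eq0 => /eqP n0.
by exists (\dim {: L}).
Qed.

End LocalAlgebra.

(** * The endomorphism algebra of an indecomposable object *)

Section EndomorphismAlgebra.
Variables (k : fieldType) (C : linCat k) (X : C).

(** The nonvanishing of the identity is a parameter since the algebra structures
    used here are nontrivial ones. *)
Definition endo_alg of idm X != 0 : Type := End X.

Variable X_neq0 : idm X != 0.
Local Notation A := (endo_alg X_neq0).

HB.instance Definition _ := Vector.copy A (End X).

Definition endo_mul (f g : A) : A := (f : End X) \oc (g : End X).

Lemma endo_mulA : associative endo_mul.
Proof. by move=> f g h; apply: compmA. Qed.
Lemma endo_mul1m : left_id (idm X : A) endo_mul.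
Proof. by move=> f; apply: comp1m. Qed.
Lemma endo_mulm1 : right_id (idm X : A) endo_mul.
Proof. by move=> f; apply: compm1. Qed.
Lemma endo_mulDl : left_distributive endo_mul +%R.
Proof. by move=> f g h; apply: compDm. Qed.
Lemma endo_mulDr : right_distributive endo_mul +%R.
Proof. by move=> f g h; apply: compmD. Qed.

HB.instance Definition _ := GRing.Zmodule_isNzRing.Build A
  endo_mulA endo_mul1m endo_mulm1 endo_mulDl endo_mulDr X_neq0.

Lemma endo_scaleAl (a : k) (f g : A) : a *: (f * g) = (a *: f) * g.
Proof. by rewrite -compZm. Qed.
HB.instance Definition _ := GRing.Lmodule_isLalgebra.Build k A endo_scaleAl.

Lemma endo_scaleAr (a : k) (f g : A) : a *: (f * g) = f * (a *: g).
Proof. by rewrite -compmZ. Qed.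
HB.instance Definition _ := GRing.Lalgebra_isAlgebra.Build k A endo_scaleAr.

HB.instance Definition _ := Algebra_isFalgebra.Build k A.

Lemma nilpotent_endoE (f : A) :
  nilpotent_endo (f : End X) <-> exists n, f ^+ n = 0.
Proof.
have iterE n : iter n (fun g : End X => (f : End X) \oc g) (idm X) = f ^+ n.
  by elim: n => [|n IHn] //=; rewrite exprS IHn.
by split=> -[n fn0]; exists n; rewrite -fn0 iterE.
Qed.

End EndomorphismAlgebra.

Section Indecomposable.
Variables (k : closedFieldType) (C : linCat k) (X : C).
Hypotheses (hidem : idempotent_complete C) (hX : indecomposable X).

Lemma indecomposable_neq0 : idm X != 0.
Proof. by apply/eqP; case: hX. Qed.

Local Notation A := (endo_alg indecomposable_neq0).

(** The images of e and of 1 - e split X, so that one of them is zero. *)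
Lemma indecomposable_idempotent (e : A) : e * e = e -> e = 0 \/ e = 1.
Proof.
move=> ee; have ee' : (1 - e) * (1 - e) = 1 - e.
  by rewrite mulrBr mulr1 mulrBl mul1r ee subrr subr0.
have [Y [i [p [pi ip]]]] := hidem ee.
have [Z [j [q [qj jq]]]] := hidem ee'.
have pj0 : p \oc j = 0.
  rewrite -[p]comp1m -pi -[j]compm1 -qj -!compmA [i \oc (p \oc _)]compmA.
  rewrite ip [j \oc _]compmA jq.
  have -> : e \oc ((1 - e : A) \oc j) = (e * (1 - e) : A) \oc j.
    by rewrite [RHS]/=; rewrite compmA.
  by rewrite mulrBr mulr1 ee subrr comp0m compm0.
have qi0 : q \oc i = 0.
  rewrite -[q]comp1m -qj -[i]compm1 -pi -!compmA [j \oc (q \oc _)]compmA.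
  rewrite jq [i \oc _]compmA ip.
  have -> : (1 - e : A) \oc (e \oc i) = ((1 - e) * e : A) \oc i.
    by rewrite compmA.
  by rewrite mulrBl mul1r ee subrr comp0m compm0.
have ds : direct_sum X Y Z.
  exists i, j, p, q; split=> //; rewrite ip jq.
  exact: (subrKC e 1).
have [Y0|Z0] := hX.2 _ _ ds.
  by left; rewrite -ip -[i]compm1 Y0 compm0 comp0m.
right; apply/eqP; rewrite eq_sym -subr_eq0; apply/eqP.
by rewrite -jq -[j]compm1 Z0 compm0 comp0m.
Qed.

Definition End_eigenvalue (f : End X) : k^o := residue (f : A).

Lemma End_eigenvalue_linear : linear End_eigenvalue.
Proof. exact: residue_linear indecomposable_idempotent. Qed.

HB.instance Definition _ := GRing.isLinear.Build k (End X) k^o _ End_eigenvalue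
  End_eigenvalue_linear.

(** The radical is taken as a kernel on [End X] itself: the vector space
    structure of [endo_alg] is a copy, so that its subspaces have another type. *)
Definition End_radical : {vspace End X} := lker (linfun End_eigenvalue).

Lemma mem_End_radical (f : End X) :
  (f \in End_radical) = ((f : A) \isn't a GRing.unit).
Proof.
rewrite memv_ker lfunE /=; apply/eqP/idP => [r0|fN].
  by have := residueP (f : A); rewrite -/(End_eigenvalue f) r0 scale0r subr0.
by apply: (residue_uniq indecomposable_idempotent); rewrite scale0r subr0.
Qed.

Lemma mem_radicalE (f : A) : (f \in radical A) = ((f : End X) \in End_radical).
Proof.
exact: etrans (mem_radical indecomposable_idempotent f) (esym (mem_End_radical f)).
Qed.

Lemma End_radical_nilpotent : nilpotent_space End_radical.
Proof.
have [n Jn0] := radical_nilpotent indecomposable_idempotent.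
exists n.+1 => s size_s sJ.
suff : (foldr (fun f g : End X => f \oc g) (idm X) s : A) \in (radical A ^+ size s)%VS.
  by rewrite size_s Jn0 memv0 => /eqP.
elim: s {size_s} sJ => [|f s IHs] sJ; first by rewrite memv_line.
rewrite [size _]/= expvSl; apply: memv_mul; last first.
  by apply: IHs => g gs; apply: sJ; rewrite in_cons gs orbT.
rewrite mem_radicalE.
by apply: sJ; rewrite mem_head.
Qed.

Lemma End_radical_ideal : two_sided_ideal End_radical.
Proof.
move=> f g; rewrite !mem_End_radical => fN.
by split; [apply: (nonunitMl indecomposable_idempotent (g : A))
          | apply: (nonunitMr indecomposable_idempotent (g : A))].
Qed.

Lemma End_radicalP (f : End X) : f \in End_radical <-> nilpotent_endo f.
Proof.
rewrite mem_End_radical.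
have nilpE := nilpotent_endoE (f : A); split.
  by move=> /(nonunit_nilpotent indecomposable_idempotent)/nilpE.
by move=> /nilpE[n]; apply: nilpotent_nonunit.
Qed.

Lemma End_radical_compl (f : End X) :
  f \notin End_radical -> exists g : End X, g \oc f = idm X /\ f \oc g = idm X.
Proof.
rewrite mem_End_radical negbK => /(@unitrP A)[g [gf fg]].
by exists g.
Qed.

Lemma End_residue (f : End X) : exists a : k, f - a *: idm X \in End_radical.
Proof.
have [a aP] := eigenvalue_exists (f : A).
by exists a; rewrite mem_End_radical.
Qed.

(** If P holds on the power J^(n+1) of the radical, then the step proves it on
    J^n, since f z f lies in J^(n+1) for f in J^n and n > 0; and P holds on the
    powers that vanish. *)
Lemma End_radical_ind (P : End X -> Prop) :
  P 0 ->
  (forall f, f \in End_radical -> (forall z : End X, P (f \oc (z \oc f))) -> P f) ->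
  forall f, f \in End_radical -> P f.
Proof.
move=> P0 PJ; pose J := radical A.
have inJ n (f : A) : f \in (J ^+ n.+1)%VS -> (f : End X) \in End_radical.
  have /subvP sub : (J ^+ n.+1 <= J)%VS.
    rewrite expvSl; apply/prodvP => u v.
    rewrite !(mem_radical indecomposable_idempotent) => uN _.
    exact: (nonunitMr indecomposable_idempotent).
  by move=> /sub; rewrite mem_radicalE.
have [n0 Jn0] := radical_nilpotent indecomposable_idempotent.
have Ppow m n : (n0 <= n + m)%N -> forall f : A, f \in (J ^+ n.+1)%VS -> P f.
  elim: m n => [|m IHm] n le_n f fJ.
    move: le_n fJ; rewrite addn0 => le_n; rewrite -(subnK le_n) -addnS expvD Jn0.
    by rewrite prodv0 memv0 => /eqP ->.
  apply: PJ => [|z]; first exact: inJ fJ.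
  apply: (IHm n.+1); first by rewrite addSnnS.
  rewrite compmA [(J ^+ n.+2)%VS]expvSl; apply: memv_mul => //.
  by rewrite mem_radicalE; case: (End_radical_ideal z (inJ _ _ fJ)).
move=> f fJ; by apply: (Ppow n0 0).
Qed.

End Indecomposable.

(** * Duality and the quantum trace *)

Section Duality.
Variables (k : fieldType) (C : monCat k).
Implicit Types A B D U V W X Y Z : C.
Local Notation "1" := (unit_obj C) : cat_scope.

Lemma snakeR_comp U X V V' (t : hom 1 (U \ox X)) (q : hom (X \ox V) 1) (g : hom V' V) :
  snakeR t (q \oc (idm X \om g)) = snakeR t q \oc g.
Proof.
apply: tens1l_faithful; rewrite tens_compr -!snakeR_tens cap_tensm tensm_id.
by rewrite -!compmA -tens_swap.
Qed.

Lemma snakeL_comp U U' X V V' (q : hom (U \ox X) 1) (r : hom 1 (X \ox V))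
    (f : hom U' U) (g : hom V V') :
  snakeL (q \oc (f \om idm X)) ((idm X \om g) \oc r) = g \oc snakeL q r \oc f.
Proof.
apply: tens1l_faithful; rewrite !tens_compr -!snakeL_tens cap_tensm cup_tensm.
rewrite tensm_id !tens_compl -!compmA cup_nat [RHS]compmA -tens_swap -!compmA.
by rewrite (pre2 (tens_swap _ _)) -!compmA.
Qed.

Section SnakeIdentity.
Variables (X W : C) (t : hom 1 (X \ox W)) (e : hom (W \ox X) 1).
Hypothesis te : snakeR t e = idm X.

Lemma snakeR_id A : cap e (A \ox X) \oc (cup t A \om idm X) = idm (A \ox X).
Proof. by rewrite snakeR_tens te tensm_id. Qed.

(** Two consecutive zigzags of W contain a zigzag of X, which straightens. *)
Lemma snakeL_idem : snakeL e t \oc snakeL e t = snakeL e t.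
Proof.
apply: tens1l_faithful; rewrite tens_compr -!snakeL_tens -compmA.
rewrite [cup t _ \oc _]compmA cup_nat -[_ \oc cup t _ \oc cup t _]compmA cup_nat.
rewrite !compmA -!tens_compl -cap_nat.
by rewrite -[X in X \om _]compmA snakeR_id compm1.
Qed.

(** A zigzag of W may be inserted on the strand W: the enlarged zigzag
    straightens in two steps. So restricting to the image of the idempotent does
    not spoil the first zigzag identity. *)
Lemma snakeR_split D (i : hom D W) (p : hom W D) : i \oc p = snakeL e t ->
  snakeR ((idm X \om p) \oc t) (e \oc (i \om idm X)) = idm X.
Proof.
move=> ip; apply: tens1l_faithful; rewrite -snakeR_tens cap_tensm cup_tensm.
rewrite tensm_id tens_compl -compmA (pre2 (esym (tens_compl _ _ _))) -tens_compr ip.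
rewrite -snakeL_tens tens_compl compmA !compmA -cap_nat.
by rewrite -[_ \oc cap e _ \oc _]compmA snakeR_id compm1 snakeR_id.
Qed.

Lemma snakeL_split D (i : hom D W) (p : hom W D) :
  p \oc i = idm D -> i \oc p = snakeL e t ->
  snakeL (e \oc (i \om idm X)) ((idm X \om p) \oc t) = idm D.
Proof.
by move=> pi ip; rewrite snakeL_comp -ip -!compmA pi compm1.
Qed.

End SnakeIdentity.

Lemma left_dual_of_snake X W (t : hom 1 (X \ox W)) (e : hom (W \ox X) 1)
    (g : End X) :
  idempotent_complete C -> snakeR t e \oc g = idm X -> has_left_dual X.
Proof.
move=> hidem teg; have te : snakeR t (e \oc (idm W \om g)) = idm X.
  by rewrite snakeR_comp.
have [D [i [p [pi ip]]]] := hidem _ _ (snakeL_idem te).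
have zr := snakeR_split te ip; have zl := snakeL_split pi ip.
by exists D; split; apply: (Duality (ev := _) (coev := _));
  [rewrite -snakeRE; apply: zr | rewrite -snakeLE; apply: zl].
Qed.

Lemma duality_snakeR D X (d : duality D X) : snakeR (coev d) (ev d) = idm X.
Proof. by rewrite snakeRE zigzag_r. Qed.

Lemma duality_snakeL D X (d : duality D X) : snakeL (ev d) (coev d) = idm D.
Proof. by rewrite snakeLE zigzag_l. Qed.

(** The transpose of r contains a cap that forms a zigzag of X with the
    coevaluation; straightening it leaves r. *)
Lemma cup_mate D X (d : duality D X) V (r : hom 1 (X \ox V)) A :
  (idm (A \ox X) \om snakeL (ev d) r) \oc cup (coev d) A = cup r A.
Proof.
rewrite -snakeL_tens -compmA cup_nat compmA -tens_compl.
by rewrite (snakeR_id (duality_snakeR d)) tensm_id comp1m.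
Qed.

Lemma cap_mate D X (d : duality D X) V (q : hom (V \ox X) 1) A :
  cap (ev d) A \oc ((idm A \om snakeL q (coev d)) \om idm X) = cap q A.
Proof.
rewrite -snakeL_tens tens_compl compmA -cap_nat -compmA.
by rewrite (snakeR_id (duality_snakeR d)) compm1.
Qed.

Lemma cap_cup_inj X Y X' Y' (q : hom (X \ox Y) 1) (t : hom 1 (X \ox Y))
    (q' : hom (X' \ox Y') 1) (t' : hom 1 (X' \ox Y')) :
  cap q 1 \oc cup t 1 = cap q' 1 \oc cup t' 1 -> q \oc t = q' \oc t'.
Proof.
rewrite !cap_cup => /(iso_mono (runitK _))/(iso_epi (runitK _)).
exact: tens1l_faithful.
Qed.

End Duality.

Section BraidedDuality.
Variables (k : fieldType) (C : braidedCat k).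
Implicit Types A D U V W X Y Z : C.
Local Notation "1" := (unit_obj C) : cat_scope.

Section OppositeDual.
Variables (D X : C) (d : duality D X).
Let e' : hom (X \ox D) 1 := ev d \oc braid X D.
Let t' : hom 1 (D \ox X) := braidV D X \oc coev d.

(** The evaluation is twisted by the braiding and the coevaluation by the
    inverse braiding, so that sliding the cup with the inverse braiding cancels
    all crossings. *)
Lemma braided_snakeR : snakeR t' e' = idm D.
Proof.
apply: tens1l_faithful; rewrite -snakeR_tens -(mirror_slide_cup D) cap_braid.
rewrite -compmA (pre2 (brVK _ _ _)) comp1m cup_braidV.
have capE : cap (ev d) (1 \ox D) \oc ((brV D D 1 \om idm X) \oc brV D X (1 \ox D))
    = cap (ev d) 1 \om idm D.
  rewrite -(slide_cap D) -!compmA (pre2 (esym (tens_compl _ _ _))) brVK tensm_id.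
  by rewrite comp1m brVK compm1.
rewrite (pre3 capE) (snakeL_tens _ _ 1) duality_snakeL.
by rewrite !tensm_id.
Qed.

Lemma braided_snakeL : snakeL e' t' = idm X.
Proof.
apply: tens1l_faithful; rewrite -snakeL_tens cap_braid tens_compl -compmA.
have cupE : (br X D 1 \om idm X) \oc cup t' (1 \ox X)
    = brV X X (1 \ox D) \oc (cup t' 1 \om idm X).
  by rewrite -(slide_cup X) (pre2 (brK _ _ _)) comp1m.
rewrite cupE cup_braidV tens_compl (pre3 (mirror_slide_cap _ _ _)).
by rewrite (snakeR_id (duality_snakeR d)) tensm_id.
Qed.

Definition braided_dual : duality X D :=
  Duality (etrans (esym (snakeRE t' e')) braided_snakeR)
          (etrans (esym (snakeLE e' t')) braided_snakeL).

End OppositeDual.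

Lemma quantum_traceE D X (d : duality D X) (f : End X) :
  quantum_trace d f = (ev d \oc braid X D) \oc ((f \om idm D) \oc coev d).
Proof. by rewrite /quantum_trace -!compmA (pre2 (braid_nat _ _)) -!compmA. Qed.

Lemma quantum_trace_negligible D X (d : duality D X) (f : End X) :
  negligible f -> quantum_trace d f = 0.
Proof. by rewrite quantum_traceE; apply. Qed.

Lemma quantum_traceD D X (d : duality D X) (f g : End X) :
  quantum_trace d (f + g) = quantum_trace d f + quantum_trace d g.
Proof. by rewrite !quantum_traceE tensDm compDm compmD. Qed.

Lemma quantum_traceZ D X (d : duality D X) a (f : End X) :
  quantum_trace d (a *: f) = a *: quantum_trace d f.
Proof. by rewrite !quantum_traceE tensZm compZm compmZ. Qed.

(** Transpose r by the duality d and then q by the duality obtained from the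
    braiding: what remains between the cup and the cap is an endomorphism of X. *)
Lemma quantum_trace_nondegenerate D X (d : duality D X) V
    (q : hom (X \ox V) 1) (r : hom 1 (X \ox V)) :
  exists a : End X, q \oc r = quantum_trace d a.
Proof.
pose rho := snakeL (ev d) r; pose q' := q \oc (idm X \om rho).
exists (snakeL q' (coev (braided_dual d))).
rewrite quantum_traceE compmA; apply: cap_cup_inj.
rewrite cap_tensm (cap_mate (braided_dual d)) cap_tensm tensm_id -compmA.
by rewrite cup_mate.
Qed.

End BraidedDuality.

(** * Non-negligible objects of moderate growth *)

Section NonNegligible.
Variables (k : closedFieldType) (C : braidedCat k).
Local Notation "1" := (unit_obj C) : cat_scope.
Hypotheses (hcauchy : cauchy_complete C) (hunit : end_unit_is_base_field C).
Variable X : C.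
Hypotheses (hindec : indecomposable X) (hnonneg : non_negligible X)
  (hgrowth : moderate_growth X).

Lemma id_unit_neq0 : idm 1 != 0 :> End 1.
Proof.
apply/eqP => id0; have /eqP : (1%R : k) = 0.
  by apply: (bij_inj hunit); rewrite id0 !scaler0.
by rewrite oner_eq0.
Qed.

Local Notation J := (End_radical hindec).

(** Rescale h to make the pairing equal to 1; otherwise [fact_le_dim_End]
    contradicts moderate growth. *)
Lemma snake_not_negligible W (t : hom 1 (X \ox W)) (q : hom (X \ox W) 1)
    (h : End X) :
  q \oc ((h \om idm W) \oc t) <> 0 ->
  ~ negligible (h \oc (snakeR t (q \oc braidV X W) \oc h)).
Proof.
move=> qht_neq0 hzh; have [g _ gK] := hunit.
set a := g (q \oc ((h \om idm W) \oc t)).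
have qhtE : q \oc ((h \om idm W) \oc t) = a *: idm 1 by rewrite gK.
have a_neq0 : a != 0.
  by apply/eqP => a0; apply: qht_neq0; rewrite qhtE a0 scale0r.
have [n] := hgrowth; apply/negP; rewrite -leqNgt.
apply: (fact_le_dim_End (t := t) (q := q) (h := a^-1 *: h)).
- by rewrite tensZm compZm compmZ qhtE scalerA mulVf // scale1r.
- rewrite !(compZm, compmZ) scalerA -[_ \oc (_ \oc h)]compm1 -compmZ.
  exact: negligible_compr.
- exact: id_unit_neq0.
Qed.

(** A nonzero pairing for h in J would make h z h non-negligible, so that
    [End_radical_ind] applies. *)
Lemma nilpotent_negligible (f : End X) : f \in J -> negligible f.
Proof.
apply: (@End_radical_ind _ _ _ hcauchy.2 hindec) => [|h hJ hzh]; first exact: negligible0.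
move=> V q r; apply/eqP/negPn/negP => /eqP.
by move=> /snake_not_negligible; apply.
Qed.

Lemma nonnegligible_pairing :
  exists W (t : hom 1 (X \ox W)) (q : hom (X \ox W) 1), q \oc t = idm 1.
Proof.
have [Y [Z [i [_ [p [_ [pi _ _ _ _]]]]]]] := hnonneg.
exists Y, (braid Y X \oc i), (p \oc braidV Y X).
by rewrite -compmA (pre2 (braidK _ _)) comp1m.
Qed.

Lemma id_not_negligible : ~ negligible (idm X).
Proof.
have [W [t [q qt]]] := nonnegligible_pairing.
move=> /(_ W q t)/eqP; rewrite tensm_id comp1m qt.
by rewrite (negPf id_unit_neq0).
Qed.

Lemma left_dual_exists : has_left_dual X.
Proof.
have [W [t [q qt]]] := nonnegligible_pairing.
pose z := snakeR t (q \oc braidV X W).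
have /(End_radical_compl hcauchy.2)[g [_ zg]] : z \notin J.
  apply/negP => /nilpotent_negligible z_negl.
  have := @snake_not_negligible W t q (idm X); rewrite tensm_id comp1m qt.
  rewrite compm1 comp1m => not_negl; apply: not_negl z_negl.
  exact/eqP/id_unit_neq0.
exact: left_dual_of_snake hcauchy.2 zg.
Qed.

Lemma rigidX : rigid X.
Proof.
split; first exact: left_dual_exists.
by have [D [d]] := left_dual_exists; exists D; split; apply: braided_dual d.
Qed.

Variables (D : C) (d : duality D X).

Lemma quantum_trace_nilpotent (f : End X) : f \in J -> quantum_trace d f = 0.
Proof. by move=> /nilpotent_negligible/quantum_trace_negligible. Qed.

(** Otherwise the trace would vanish on k + J = End(X), and then all pairings of
    X would vanish by [quantum_trace_nondegenerate]. *)
Lemma quantum_trace_id : quantum_trace d (idm X) <> 0.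
Proof.
move=> tr0; apply: id_not_negligible => V q r; rewrite tensm_id comp1m.
have [f ->] := quantum_trace_nondegenerate d q r.
have [a faJ] := End_residue hcauchy.2 hindec f.
rewrite -[f](subrK (a *: idm X)) quantum_traceD quantum_traceZ tr0 scaler0 addr0.
exact: quantum_trace_nilpotent.
Qed.

Lemma quantum_trace_eq0 (f : End X) : quantum_trace d f = 0 -> f \in J.
Proof.
have [a faJ] := End_residue hcauchy.2 hindec f.
rewrite -{1}[f](subrK (a *: idm X)) quantum_traceD quantum_traceZ.
rewrite quantum_trace_nilpotent // add0r => /eqP.
rewrite scaler_eq0 => /orP[/eqP a0|/eqP /quantum_trace_id //].
by rewrite a0 scale0r subr0 in faJ.
Qed.

End NonNegligible.

Lemma nilradical_nilpotent (k : fieldType) (C : linCat k) (X : C) (f : End X) :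
  nilradical f -> nilpotent_endo f.
Proof.
case=> I [_ [n In0] fI]; exists n.
have := In0 (nseq n f) (size_nseq n f).
have -> m : foldr (fun f g : End X => f \oc g) (idm X) (nseq m f)
    = iter m (fun g : End X => f \oc g) (idm X) by elim: m => //= m ->.
by apply=> g /nseqP[-> _].
Qed.

Theorem corollary1p5 (k : closedFieldType) (C : braidedCat k)
    (hcauchy : cauchy_complete C) (hunit : end_unit_is_base_field C)
    (X : C) (hindec : indecomposable X) (hnonneg : non_negligible X)
    (hgrowth : moderate_growth X) :
  rigid X /\
  forall (D : C) (d : duality D X),
    [/\ forall f : End X, nilradical f <-> quantum_trace d f = 0,
        forall f : End X, nilpotent_endo f -> quantum_trace d f = 0
      & quantum_trace d (idm X) <> 0].
Proof.
split; first exact: rigidX.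
move=> D d.
have nil_tr0 (f : End X) : nilpotent_endo f -> quantum_trace d f = 0.
  move=> /(End_radicalP hcauchy.2 hindec).
  exact: (quantum_trace_nilpotent hcauchy hunit hgrowth).
split=> //; last exact: (quantum_trace_id hcauchy hunit hindec).
move=> f; split; first by move/nilradical_nilpotent/nil_tr0.
move=> /(quantum_trace_eq0 hcauchy hunit hindec hnonneg hgrowth) fJ.
exists (End_radical hindec); split=> //.
  exact: (End_radical_ideal hcauchy.2).
exact: (End_radical_nilpotent hcauchy.2).
Qed.
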